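(* Let $R$ be a nonzero associative unital ring, $n$ a positive integer, $G$ a group, and $\rho$ a preorder on $\overline{n}=\{1,\ldots,n\}$. Suppose that $\rho$ is $G$-graded by $(\rho_g)_{g\in G}$. If we put $M_n(\rho,R)_g:=\sum_{(i,j)\in\rho_g}Re_{i,j}$ for all $g\in G$, then this defines a $G$-grading on the ring $M_n(\rho,R)$.
   Context: For $X,Y\subseteq\overline{n}\times\overline{n}$ put $XY=\{(i,k)\mid \exists j\in\overline{n}:\ (i,j)\in X,\ (j,k)\in Y\}$. A preorder is a reflexive and transitive relation. A $G$-grading on $\rho$ is a family $(\rho_g)_{g\in G}$ of pairwise disjoint (possibly empty) subsets of $\rho$ with $\rho=\bigcup_{g\in G}\rho_g$ and $\rho_g\rho_h\subseteq\rho_{gh}$ for all $g,h\in G$. $e_{i,j}$ is the $n\times n$ matrix over $R$ with $1$ in position $(i,j)$ and zeros elsewhere; the structural matrix ring is the additive subgroup $M_n(\rho,R)=\sum_{(i,j)\in\rho}Re_{i,j}$ of $M_n(R)$ with ordinary matrix multiplication. A $G$-grading on a unital ring $S$ is a family $(S_g)_{g\in G}$ of additive subgroups with $S=\bigoplus_{g\in G}S_g$ and $S_gS_h\subseteq S_{gh}$ for all $g,h\in G$. *)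

(* Defs.v *)
(* MathComp, with finmap for finitely supported families and boolp for
   coercing a mathematical property to a boolean predicate. *)
From HB Require Import structures.
From mathcomp Require Import all_boot all_order all_algebra.
From mathcomp Require Import finmap boolp.

Set Implicit Arguments.
Unset Strict Implicit.
Unset Printing Implicit Defensive.

Import GRing.Theory.
Local Open Scope ring_scope.

(* The index set {1, ..., n} is 'I_n = {0, ..., n - 1}. *)
Definition rel_prod (n : nat) (X Y : {set 'I_n * 'I_n}) : {set 'I_n * 'I_n} :=
  [set p | [exists j, ((p.1, j) \in X) && ((j, p.2) \in Y)]].

Record preord (n : nat) := Preord {
  preord_set :> {set 'I_n * 'I_n};
  preord_refl : forall i, (i, i) \in preord_set;
  preord_trans : forall i j k,
    (i, j) \in preord_set -> (j, k) \in preord_set -> (i, k) \in preord_set }.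

(* The inclusions rho_ g \subset rho are part of the second clause. *)
Definition preord_grading (G : groupType) (n : nat) (rho : preord n)
    (rho_ : G -> {set 'I_n * 'I_n}) : Prop :=
  [/\ forall g h, g != h -> [disjoint rho_ g & rho_ h],
      forall p, p \in preord_set rho <-> exists g, p \in rho_ g
    & forall g h, rel_prod (rho_ g) (rho_ h) \subset rho_ (g * h)%g].

(* Internal direct sum: each element has exactly one decomposition along a
   finitely supported family (G may be infinite). *)
Definition direct_sum (G : choiceType) (S : zmodType) (S_ : G -> {pred S}) :
    Prop :=
  forall s : S, exists! x : {fsfun G -> S with 0},
    (forall g, x g \in S_ g) /\ s = \sum_(g <- finsupp x) x g.

Definition ring_grading (G : groupType) (S : pzRingType)
    (S_ : G -> {pred S}) : Prop :=
  [/\ forall g, zmod_closed (S_ g),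
      direct_sum S_
    & forall g h a b, a \in S_ g -> b \in S_ h -> a * b \in S_ (g * h)%g].

(* The subset \sum_((i, j) in X) R e_{i,j} of 'M[R]_n. *)
Definition unit_span (R : nzRingType) (n : nat) (X : {set 'I_n * 'I_n}) :
    {pred 'M[R]_n} :=
  fun A => `[< exists c : 'I_n * 'I_n -> R,
                 A = \sum_(p in X) c p *: delta_mx p.1 p.2 >].
Arguments unit_span R {n} X.

Lemma sum_unitE (R : nzRingType) (n : nat) (X : {set 'I_n * 'I_n})
    (c : 'I_n * 'I_n -> R) i j :
  (\sum_(p in X) c p *: delta_mx p.1 p.2 : 'M[R]_n) i j
    = if (i, j) \in X then c (i, j) else 0.
Proof.
rewrite summxE; case: ifP => ijX.
  rewrite (bigD1 (i, j)) //= !mxE !eqxx mulr1 big1 ?addr0 // => -[k l] /=.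
  by case/andP=> _; rewrite xpair_eqE !mxE eq_sym [l == j]eq_sym => /negPf->;
     rewrite mulr0.
apply: big1 => -[k l] /= klX; rewrite !mxE.
case: eqP => [ik|_]; last by rewrite mulr0.
case: eqP => [jl|_]; last by rewrite mulr0.
by rewrite ik jl klX in ijX.
Qed.

Lemma unit_spanP (R : nzRingType) (n : nat) (X : {set 'I_n * 'I_n})
    (A : 'M[R]_n) :
  reflect (forall i j, (i, j) \notin X -> A i j = 0) (A \in unit_span R X).
Proof.
apply: (iffP (asboolP _)) => [[c ->] i j /negPf ijX | A0].
  by rewrite sum_unitE ijX.
exists (fun p => A p.1 p.2); apply/matrixP=> i j; rewrite sum_unitE.
by case: ifPn => // /A0.
Qed.

Lemma unit_span_zmod_closed (R : nzRingType) (n : nat)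
    (X : {set 'I_n * 'I_n}) : zmod_closed (unit_span R X).
Proof.
split=> [|A B /unit_spanP A0 /unit_spanP B0]; apply/unit_spanP => i j ijX.
  by rewrite mxE.
by rewrite !mxE A0 // B0 // subr0.
Qed.

Lemma unit_span_subring_closed (R : nzRingType) (n : nat) (rho : preord n) :
  subring_closed (unit_span R rho).
Proof.
have [_ subA] := unit_span_zmod_closed R (preord_set rho).
split=> // [|A B /unit_spanP A0 /unit_spanP B0]; apply/unit_spanP => i k ikX.
  rewrite mxE; case: eqP => // ik.
  by move: ikX; rewrite ik preord_refl.
rewrite mxE big1 // => j _.
have [ijX|/A0->] := boolP ((i, j) \in preord_set rho); last by rewrite mul0r.
have [jkX|/B0->] := boolP ((j, k) \in preord_set rho); last by rewrite mulr0.
by move: ikX; rewrite (preord_trans ijX jkX).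
Qed.

(* The structural matrix ring M_n(rho, R), as a subring of 'M[R]_n. *)
Record structmx (R : nzRingType) (n : nat) (rho : preord n) := StructMx {
  structmx_val :> 'M[R]_n;
  structmx_in : structmx_val \in unit_span R rho }.

HB.instance Definition _ (R : nzRingType) (n : nat) (rho : preord n) :=
  [isSub for @structmx_val R n rho].
HB.instance Definition _ (R : nzRingType) (n : nat) (rho : preord n) :=
  [Choice of structmx R rho by <:].
HB.instance Definition _ (R : nzRingType) (n : nat) (rho : preord n) :=
  GRing.SubChoice_isSubPzRing.Build 'M[R]_n (unit_span R rho) (structmx R rho)
    (unit_span_subring_closed R rho).

(* The subset \sum_((i, j) in X) R e_{i,j} of M_n(rho, R), for X contained
   in rho. *)
Definition structmx_span (R : nzRingType) (n : nat) (rho : preord n)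
    (X : {set 'I_n * 'I_n}) : {pred structmx R rho} :=
  fun A => structmx_val A \in unit_span R X.
Arguments structmx_span R {n} rho X.

(* Main.v *)
(** Every position of [rho] has exactly one degree, so in a sum of matrices
    lying in the different components at most one summand contributes to a given
    entry.  Hence the [g]-part of a matrix must be its restriction to the
    positions of degree [g], and these restrictions do add up to the matrix,
    finitely many of them being nonzero because [rho] is finite. *)

Require Import Defs.
From HB Require Import structures.
From mathcomp Require Import all_boot all_order all_algebra.
From mathcomp Require Import finmap.

Set Implicit Arguments.
Unset Strict Implicit.
Unset Printing Implicit Defensive.

Import GRing.Theory.
Local Open Scope ring_scope.

(** At a position [(i, k)] outside [rel_prod X Y], every [j] has [(i, j)] outside [X] or [(j, k)]
    outside [Y], so each term of the entry has a zero factor. *)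
Lemma unit_span_mul (R : nzRingType) (n : nat) (X Y : {set 'I_n * 'I_n})
    (A B : 'M[R]_n) :
  A \in unit_span R X -> B \in unit_span R Y ->
  A *m B \in unit_span R (rel_prod X Y).
Proof.
move=> /unit_spanP A0 /unit_spanP B0; apply/unit_spanP=> i k.
rewrite inE negb_exists => /forallP ik; rewrite mxE big1 // => j _.
by case/nandP: (ik j) => [/A0-> | /B0->]; rewrite (mul0r, mulr0).
Qed.

Lemma unit_spanS (R : nzRingType) (n : nat) (X Y : {set 'I_n * 'I_n})
    (A : 'M[R]_n) :
  X \subset Y -> A \in unit_span R X -> A \in unit_span R Y.
Proof.
move=> /subsetP XY /unit_spanP A0; apply/unit_spanP=> i j ijY.
by apply: A0; apply: contra ijY; apply: XY.
Qed.

Section Restriction.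
Variables (R : nzRingType) (n : nat) (rho : preord n) (X : {set 'I_n * 'I_n}).

Definition mxrestr (A : 'M[R]_n) : 'M[R]_n :=
  \matrix_(i, j) if (i, j) \in X then A i j else 0.

Lemma mxrestr_span A : mxrestr A \in unit_span R X.
Proof. by apply/unit_spanP=> i j /negPf ijX; rewrite mxE ijX. Qed.

(** Off [rho] the entries of [A] are already zero, whatever [X] is. *)
Lemma mxrestr_structmx (A : structmx R rho) : mxrestr A \in unit_span R rho.
Proof.
apply/unit_spanP=> i j ij_rho; rewrite mxE.
by rewrite (unit_spanP _ _ (structmx_in A)) ?if_same.
Qed.

Definition structmx_restr (A : structmx R rho) : structmx R rho :=
  StructMx (mxrestr_structmx A).

End Restriction.

Section DirectSum.
Variables (R : nzRingType) (n : nat) (G : groupType) (rho : preord n).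
Variable rho_ : G -> {set 'I_n * 'I_n}.
Hypothesis rho_disj : forall g h, g != h -> [disjoint rho_ g & rho_ h].
Hypothesis rho_cover :
  forall p, p \in preord_set rho <-> exists g, p \in rho_ g.

(** Serves both halves of directness: it shows that the restrictions sum to the matrix, and it
    forces the entries of any other decomposition. *)
Lemma structmx_sum_entry (x : {fsfun G -> structmx R rho with 0}) g i j :
  (forall h, x h \in structmx_span R rho (rho_ h)) -> (i, j) \in rho_ g ->
  structmx_val (\sum_(h <- finsupp x) x h) i j = structmx_val (x g) i j.
Proof.
move=> x_in ij_g; rewrite -[structmx_val (\sum_(h <- _) _)]/(val _).
rewrite raddf_sum summxE.
have x0 h : h != g -> val (x h) i j = 0.
  move=> hg; apply: (unit_spanP _ _ (x_in h)).
  by apply: contraL ij_g => ij_h; rewrite (disjointFr (rho_disj hg)).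
have [g_x | g_x] := boolP (g \in finsupp x).
  by rewrite (big_fsetD1 g) //= big_seq big1 ?addr0 // => h /fsetD1P[/x0].
(* Here [x g] is the default 0, and every [h] in the support differs from [g], so the sum has entry
   0 too. *)
rewrite (fsfun_dflt g_x) mxE big_seq big1 // => h h_x.
by apply: x0; apply: contraNneq g_x => <-.
Qed.

Lemma structmx_span_direct :
  direct_sum (fun g : G => structmx_span R rho (rho_ g)).
Proof.
move=> A.
(* The implication makes a degree available for every pair; off [rho] its value is arbitrary. *)
have degP p : exists g, (p \in preord_set rho) ==> (p \in rho_ g).
  have [/rho_cover[g p_g]|_] := boolP (p \in preord_set rho); first by exists g.
  by exists 1%g.
pose deg p := xchoose (degP p).
have deg_uniq p g : p \in rho_ g -> deg p = g.
  move=> p_g; have p_deg : p \in rho_ (deg p).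
    by apply: (implyP (xchooseP (degP p))); apply/rho_cover; exists g.
  by apply: contraTeq p_deg => /rho_disj/disjointFl->.
(* A finite set containing every [g] with [rho_ g] nonempty; extra degrees, from pairs off [rho], do
   no harm. *)
pose D := [fset deg p | p in {: 'I_n * 'I_n}]%fset.
pose x : {fsfun G -> structmx R rho with 0} :=
  [fsfun g in D => structmx_restr (rho_ g) A | 0].
have xE g : x g = structmx_restr (rho_ g) A.
  (* For [g] outside [D], [rho_ g] is empty, so the restriction is the default 0. *)
  rewrite fsfunE; case: ifPn => // gD.
  apply/val_inj/matrixP=> i j; rewrite !mxE; case: ifP => // /deg_uniq ij_g.
  by case/negP: gD; apply/imfsetP; exists (i, j).
have x_in g : x g \in structmx_span R rho (rho_ g).
  by rewrite xE; apply: mxrestr_span.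
exists x; split=> [|y [y_in defA]].
  split=> //; apply/val_inj/matrixP=> i j /=.
  have [/rho_cover[g ij_g]|ij_rho] := boolP ((i, j) \in preord_set rho).
    by rewrite (structmx_sum_entry x_in ij_g) xE mxE ij_g.
  by rewrite !(unit_spanP _ _ (structmx_in _)).
apply/fsfunP=> g; rewrite xE; apply/val_inj/matrixP=> i j; rewrite mxE.
case: ifPn => [ij_g | ij_g].
  by rewrite defA (structmx_sum_entry y_in ij_g).
by rewrite (unit_spanP _ _ (y_in g)).
Qed.

End DirectSum.

Theorem proposition16 (R : nzRingType) (n : nat) (n_gt0 : (0 < n)%N)
    (G : groupType) (rho : preord n) (rho_ : G -> {set 'I_n * 'I_n})
    (rho_graded : preord_grading rho rho_) :
  ring_grading (fun g : G => structmx_span R rho (rho_ g)).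
Proof.
case: rho_graded => rho_disj rho_cover rho_mul; split=> [g||g h A B A_g B_h].
- have [span0 spanB] := unit_span_zmod_closed R (rho_ g).
  by split=> // A B; apply: spanB.
- exact: structmx_span_direct.
(* The product in the subring unfolds to the matrix product. *)
exact: unit_spanS (rho_mul g h) (unit_span_mul A_g B_h).
Qed.
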